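(* Let $A\in\mathbb{R}^{m\times n}$, $A\ne0$, $b\in\mathbb{R}^m$ with $S_+\ne\emptyset$, $x_0\in\mathbb{R}^n_{++}$, and let $(x_k)$ be the iterates of entropic mirror descent with the Polyak-type stepsize, $$\alpha_k=\min\left\{\frac{f(x_k)}{\|\nabla f(x_k)\|^2_{x_k}},\ \frac{1.79}{\|\nabla f(x_k)\|_\infty}\right\},\qquad x_{k+1}=x_k\circ\exp(-\alpha_k\nabla f(x_k)),$$ with $f(x)=\frac12\|Ax-b\|_2^2$. Suppose $(x_k)$ converges to $z=\arg\min_{x\in S_+}D_h(x,x_0)$ and $z_{\min}>0$. Then for every $k\ge0$ $$D_h(z,x_{k+1})\le D_h(z,x_k)\left(1-\frac{-\lambda^+_{\min}\,z_{\min}\,W_0\!\left(-\exp\!\left(-1-\frac{D_h(z,x_k)}{z_{\min}}\right)\right)}{8\max_{j\le n}\|A_{:j}\|_2^2\,\big(\|z\|_1+D_h(z,x_k)\big)}\right),$$ and the same inequality holds with $D_h(z,x_k)$ replaced by $D_h(z,x_0)$ inside the fraction (a global linear rate). Consequently, asymptotically the contraction factor is $$1-\frac{\lambda^+_{\min}\,z_{\min}}{8\max_{j\le n}\|A_{:j}\|_2^2\,\|z\|_1}$$ (local linear rate).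
   Context: $S_+=\{x\in\mathbb{R}^n_+ : Ax=b\}$; $\mathbb{R}^n_{++}$ is the strictly positive orthant; $\circ$, $\exp$ act componentwise; $\nabla f(x)=A^\top(Ax-b)$; $\|v\|_x^2=\sum_i x_iv_i^2$; $z_{\min}=\min_i z_i$; $A_{:j}$ is the $j$-th column of $A$; $\lambda^+_{\min}$ is the smallest positive eigenvalue of $A^\top A$; $W_0$ is the principal branch of the Lambert $W$ function. $h(x)=\sum_i x_i(\log x_i-1)$ (with $0\log0=0$) and $D_h(x,y)=\sum_i\big(x_i\log\frac{x_i}{y_i}-x_i+y_i\big)$ for $x\in\mathbb{R}^n_+$, $y\in\mathbb{R}^n_{++}$. *)

(* Defs.v *)
From HB Require Import structures.
From mathcomp Require Import all_boot all_order all_algebra.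
From mathcomp Require Import all_classical all_reals all_analysis.
Set Implicit Arguments. Unset Strict Implicit. Unset Printing Implicit Defensive.
Import Order.TTheory GRing.Theory Num.Theory.
Local Open Scope ring_scope.
Local Open Scope classical_set_scope.

Section Defs.
Variable R : realType.

Definition Splus (m n : nat) (A : 'M[R]_(m, n)) (b : 'cV[R]_m) : set 'cV[R]_n :=
  [set x : 'cV[R]_n | (forall i, 0 <= x i 0) /\ A *m x = b].

Definition lsq (m n : nat) (A : 'M[R]_(m, n)) (b : 'cV[R]_m) (x : 'cV[R]_n) : R :=
  2^-1 * \sum_i (((A *m x) - b) i 0) ^+ 2.

Definition lsq_grad (m n : nat) (A : 'M[R]_(m, n)) (b : 'cV[R]_m) (x : 'cV[R]_n)
  : 'cV[R]_n := A^T *m (A *m x - b).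

Definition lnorm2 (n : nat) (x v : 'cV[R]_n) : R := \sum_i x i 0 * (v i 0) ^+ 2.

Definition inf_norm (n : nat) (v : 'cV[R]_n) : R := \big[Num.max/0]_i `|v i 0|.

Definition l1_norm (n : nat) (v : 'cV[R]_n) : R := \sum_i `|v i 0|.

Definition vmin (n : nat) (v : 'cV[R]_n) : R :=
  xget 0 [set a : R | (exists i, v i 0 = a) /\ (forall i, a <= v i 0)].

Definition max_col_sqnorm (m n : nat) (A : 'M[R]_(m, n)) : R :=
  \big[Num.max/0]_j \sum_i (A i j) ^+ 2.

(* Bregman divergence of the entropy h; ln 0 = 0 in MathComp-Analysis, so
   x_i * ln (x_i / y_i) = 0 when x_i = 0, matching 0 log 0 = 0. *)
Definition Dh (n : nat) (x y : 'cV[R]_n) : R :=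
  \sum_i (x i 0 * ln (x i 0 / y i 0) - x i 0 + y i 0).

Definition lambda_min_pos (n : nat) (M : 'M[R]_n) : R :=
  xget 0 [set a : R | eigenvalue M a /\ 0 < a /\
                  (forall c, eigenvalue M c -> 0 < c -> a <= c)].

Definition LambertW0 (y : R) : R :=
  xget 0 [set w : R | -1 <= w /\ w * expR w = y].

Definition polyak_step (m n : nat) (A : 'M[R]_(m, n)) (b : 'cV[R]_m) (x : 'cV[R]_n) : R :=
  Num.min (lsq A b x / lnorm2 x (lsq_grad A b x))
          ((179%:R / 100%:R) / inf_norm (lsq_grad A b x)).

Fixpoint emd (m n : nat) (A : 'M[R]_(m, n)) (b : 'cV[R]_m) (x0 : 'cV[R]_n) (k : nat)
  : 'cV[R]_n :=
  match k with
  | 0 => x0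
  | k'.+1 => let xk := emd A b x0 k' in
             \col_i (xk i 0 * expR (- (polyak_step A b xk * lsq_grad A b xk i 0)))
  end.

Definition rate (m n : nat) (A : 'M[R]_(m, n)) (z : 'cV[R]_n) (D : R) : R :=
  1 - (- lambda_min_pos (A^T *m A) * vmin z
          * LambertW0 (- expR (-1 - D / vmin z)))
      / (8 * max_col_sqnorm A * (l1_norm z + D)).

End Defs.

(* Main.v *)
(* In the dual variable ln x the iteration is gradient descent: ln x_k - ln x_0 stays in the row space of A, and so does ln x_k - ln z by passing to the limit. With D = D_h(z, x_k) and f = f(x_k), one step costs
     D_h(z, x_(k+1)) <= D - alpha <g, x_k - z> + (4/3) alpha^2 ||g||_(x_k)^2 <= D - (2/3) alpha f,
   because exp u <= 1 + u + (4/3) u^2 for u <= 1.79 and <g, x_k - z> = 2 f. Both terms of the minimum defining alpha are at least 1 / (2 M (||x_k||_1 + ||z||_1)), where M = max_j ||A_j||^2, and ||x_k||_1 + ||z||_1 <= (8/3) (||z||_1 + D). Finally f >= lambda z_min sigma D with sigma = - W_0(- exp(-1 - D / z_min)): every coordinate of x_k is at least sigma z_min, so D_h(z, .) satisfies a Polyak-Lojasiewicz inequality along the row space of A. *)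
Require Import Defs.
From HB Require Import structures.
From mathcomp Require Import all_boot all_order all_algebra.
From mathcomp Require Import all_classical all_reals all_analysis.
From mathcomp Require Import ring lra.
Set Implicit Arguments. Unset Strict Implicit. Unset Printing Implicit Defensive.
Import Order.TTheory GRing.Theory Num.Theory.
Import numFieldNormedType.Exports.
Local Open Scope ring_scope.
Local Open Scope classical_set_scope.

(** * Elementary bounds for the exponential and the logarithm *)

Lemma le_of_derive_ge0 (R : realType) (f df : R -> R) (a b : R) :
  (forall x : R, is_derive x (1 : R) f (df x)) ->
  (forall x, a < x -> x < b -> 0 <= df x) -> a <= b -> f a <= f b.
Proof.
move=> fdf df0; rewrite le_eqVlt => /predU1P[->//|ab].
have cf : {within `[a, b], continuous f}.
  apply: continuous_subspaceT => x; apply/differentiable_continuous.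
  by apply/derivable1_diffP; have [] := fdf x.
have [c] := MVT ab (fun x _ => fdf x) cf.
rewrite in_itv /= => /andP[ac cb] e.
by rewrite -subr_ge0 e mulr_ge0 ?df0// subr_ge0 ltW.
Qed.

Lemma expR_ge_quadratic (R : realType) (t : R) :
  0 <= t -> 1 + t + t ^+ 2 / 2 <= expR t.
Proof.
move=> t0; pose f (s : R) := expR s - s - s * s * 2^-1.
have fd (s : R) : is_derive s (1 : R) f (expR s - 1 - s).
  by apply: is_derive_eq; rewrite /GRing.scale /=; lra.
suff : f 0 <= f t by rewrite /f expR0; lra.
apply: le_of_derive_ge0 fd _ t0 => s _ _.
by have := expR_ge1Dx s; lra.
Qed.

(** With x = y exp t, the right-hand side is the one-dimensional D_h(x, y) divided by y. *)
Lemma expR_ge_quadratic_dual (R : realType) (t : R) :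
  0 <= t -> t ^+ 2 / 2 <= (t - 1) * expR t + 1.
Proof.
move=> t0; pose f (s : R) := (s - 1) * expR s - s * s * 2^-1.
have fd (s : R) : is_derive s (1 : R) f (s * (expR s - 1)).
  by apply: is_derive_eq; rewrite /GRing.scale /=; lra.
suff : f 0 <= f t by rewrite /f expR0; lra.
apply: le_of_derive_ge0 fd _ t0 => s s0 _.
by rewrite mulr_ge0 ?ltW// subr_gt0 expR_gt1.
Qed.

(** Four squarings starting from exp v >= 1 + v at v = -1.79/16, rounding down each time. The bound
    is sharp enough for (1 + u + 4u^2/3) exp(-u) >= 1 at u = 1.79. *)
Lemma expRN179_ge (R : realType) : 144 / 1000 <= expR (- (179 / 100)) :> R.
Proof.
have sq (a b y : R) : 0 <= a -> a <= expR y -> b <= a ^+ 2 -> b <= expR (y *+ 2).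
  move=> a0 ay ba; rewrite -mulr_natl expRM_natl; apply: le_trans ba _.
  by rewrite lerXn2r// nnegrE expR_ge0.
have h0 := expR_ge1Dx (- (179 / 1600) : R).
have {}h0 : 888 / 1000 <= expR (- (179 / 1600) : R) by lra.
have h1 := sq _ (788 / 1000) _ _ h0.
have h2 := sq _ (620 / 1000) _ _ (h1 _ _).
have h3 := sq _ (384 / 1000) _ _ (h2 _ _ _ _).
have h4 := sq _ (144 / 1000) _ _ (h3 _ _ _ _ _ _).
have -> : - (179 / 100) = - (179 / 1600) *+ 2 *+ 2 *+ 2 *+ 2 :> R by lra.
by apply: h4; lra.
Qed.

(* The stepsize cap enters here: the right-hand side dominates exp up to some point beyond 1.79. The coefficient 4/3 leaves room both for a crude bound on exp(1.79) and for the final constant 8. *)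
Lemma expR_le_quadratic (R : realType) (u : R) :
  u <= 179 / 100 -> expR u <= 1 + u + 4 / 3 * u ^+ 2.
Proof.
move=> u1; pose f (s : R) := (1 + s + 4 / 3 * (s * s)) * expR (- s).
suff : 1 <= f u by rewrite /f expRN ler_pdivlMr ?expR_gt0// mul1r expr2.
have f0 : f 0 = 1 by rewrite /f oppr0 expR0; lra.
(* The derivative changes sign at 0 and 5/4 only: [f] decreases, increases, then decreases, so its
   minimum up to 1.79 is [f 0] or [f (179 / 100)]. *)
have fd (s : R) : is_derive s (1 : R) f (s * (5 / 3 - 4 / 3 * s) * expR (- s)).
  apply: is_derive_eq; rewrite /GRing.scale /=; lra.
have fdN (s : R) : is_derive s (1 : R) (- f) (- (s * (5 / 3 - 4 / 3 * s) * expR (- s))).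
  exact: is_deriveN.
have [u0|u0] := leP u 0.
  suff : (- f) u <= (- f) 0 by rewrite /= !fctE f0; lra.
  apply: le_of_derive_ge0 fdN _ u0 => s _ s0.
  rewrite -mulNr mulr_ge0 ?expR_ge0//; nra.
have [v|v] := leP u (5 / 4).
  rewrite -f0; apply: le_of_derive_ge0 fd _ (ltW u0) => s s0 su.
  by rewrite mulr_ge0 ?expR_ge0//; nra.
have f1 : 1 <= f (179 / 100).
  rewrite /f; have := expRN179_ge R; set e := expR _ => he; lra.
suff : (- f) u <= (- f) (179 / 100) by rewrite /= !fctE; lra.
apply: le_of_derive_ge0 fdN _ u1 => s s0 _.
rewrite -mulNr mulr_ge0 ?expR_ge0//; nra.
Qed.

Lemma ln_leB1 (R : realType) (x : R) : 0 < x -> ln x <= x - 1.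
Proof.
move=> x0; have := @le_ln1Dx R (x - 1).
by rewrite subrKC; apply; lra.
Qed.

(** * The entropy divergence in one coordinate *)

Section scalar_entropy.
Variable R : realType.
Implicit Types x y z s t : R.

Lemma ln_quot x y : 0 < x -> 0 < y -> ln (x / y) = ln x - ln y.
Proof. by move=> x0 y0; rewrite ln_div. Qed.

(** The summand of [Dh], with which it agrees by unfolding. *)
Definition dent x y := x * ln (x / y) - x + y.

Lemma dent_ge0 x y : 0 < x -> 0 < y -> 0 <= dent x y.
Proof.
move=> x0 y0; have := ln_leB1 (divr_gt0 y0 x0).
rewrite /dent !ln_quot// => h.
have := ler_wpM2l (ltW x0) h; rewrite !mulrBr [x * (y / x)]mulrC divfK ?gt_eqF//.
lra.
Qed.

(** Apply ln t <= t - 1 to both factors of y/x = (8/5) (y / (8x/5)). This split leaves 3/8 of y,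
    whence 8/3; the resulting coefficient 8/5 of x is rounded up to 5/3, so that adding one more x
    gives 8/3 again. *)
Lemma dent_mass x y : 0 < x -> 0 < y -> y <= 5 / 3 * x + 8 / 3 * dent x y.
Proof.
move=> x0 y0; rewrite /dent ln_quot//.
have h85 : 0 < 8 / 5 :> R by lra.
have h1 := ln_leB1 h85.
have h2 := ln_leB1 (divr_gt0 y0 (mulr_gt0 h85 x0)).
rewrite ln_quot ?mulr_gt0// lnM ?posrE// in h2.
have h3 : ln y - ln x <= 8 / 5 - 1 + (y / (8 / 5 * x) - 1) by lra.
have := ler_wpM2l (ltW x0) h3.
have -> : x * (8 / 5 - 1 + (y / (8 / 5 * x) - 1)) = 5 / 8 * y - 2 / 5 * x.
  by field; lra.
lra.
Qed.

Lemma dent_sum x y : 0 < x -> 0 < y ->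
  dent x y + dent y x = (x - y) * (ln x - ln y).
Proof. by move=> x0 y0; rewrite /dent !ln_quot//; ring. Qed.

(** With d = ln x - ln y, [dent x y] is both y ((d - 1) exp d + 1) and x (exp(-d) - 1 + d). The
    first form serves d >= 0, the second d < 0. *)
Lemma dent_ge_sqr_ln mu x y : 0 < x -> 0 < y -> mu <= x -> mu <= y ->
  mu / 2 * (ln x - ln y) ^+ 2 <= dent x y.
Proof.
move=> x0 y0 mx my; set d := ln x - ln y.
have yE : y = x * expR (- d).
  by rewrite /d opprB expRB !lnK ?posrE// mulrCA divff ?mulr1// gt_eqF.
have xE : x = y * expR d.
  by rewrite /d expRB !lnK ?posrE// mulrCA divff ?mulr1// gt_eqF.
rewrite /dent ln_quot// -/d.
have [d0|d0] := leP 0 d.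
  have h := expR_ge_quadratic_dual d0.
  apply: le_trans (_ : y * (d ^+ 2 / 2) <= _).
    by rewrite -mulrA [_^-1 * _]mulrC ler_wpM2r// divr_ge0 ?sqr_ge0.
  by have := ler_wpM2l (ltW y0) h; rewrite xE; lra.
have h := @expR_ge_quadratic R (- d).
have {}h := h _.
apply: le_trans (_ : x * (d ^+ 2 / 2) <= _).
  by rewrite -mulrA [_^-1 * _]mulrC ler_wpM2r// divr_ge0 ?sqr_ge0.
have {}h : d ^+ 2 / 2 <= expR (- d) - 1 + d by have := h _; rewrite sqrrN; lra.
by have := ler_wpM2l (ltW x0) h; rewrite yE; lra.
Qed.

End scalar_entropy.

(** * The principal Lambert branch near its branch point *)

Section lambert.
Variable R : realType.
Implicit Types D s t : R.

(** The intermediate value theorem on [-1, 0] supplies a root, so [xget] does not fall back on its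
    default. *)
Lemma LambertW0_def y : - expR (-1) <= y <= 0 ->
  -1 <= LambertW0 y :> R /\ LambertW0 y * expR (LambertW0 y) = y :> R.
Proof.
move=> /andP[y1 y0].
pose f (w : R) := w * expR w.
have cf : {within `[-1, 0], continuous f}.
  apply: continuous_subspaceT => x; apply: continuousM => //.
  exact: continuous_expR.
have [||c] := @IVT R f (-1) 0 y _ cf; first by lra.
  rewrite /f mul0r mulN1r; apply/andP; split.
    by rewrite ge_min y1.
  by rewrite le_max y0 orbT.
rewrite in_itv /= => /andP[c1 _] fc.
rewrite /LambertW0; case: xgetP => [w -> []//|/(_ c)]; case.
by split.
Qed.

(* [sigma t = - W0(- exp(-1 - t))] is the root in ]0, 1] of [s - 1 - ln s = t]. *)
Definition sigma t : R := - LambertW0 (- expR (-1 - t)).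

Lemma sigmaP t : 0 <= t ->
  [/\ 0 < sigma t, sigma t <= 1 & sigma t - 1 - ln (sigma t) = t].
Proof.
move=> t0; have [|h1 h2] := @LambertW0_def (- expR (-1 - t)).
  by rewrite lerN2 ler_expR oppr_le0 expR_ge0 andbT; lra.
have h3 : sigma t * expR (- sigma t) = expR (-1 - t).
  by rewrite /sigma opprK mulNr h2 opprK.
have s0 : 0 < sigma t.
  by rewrite -(pmulr_lgt0 _ (expR_gt0 (- sigma t))) h3 expR_gt0.
split => //; first by rewrite /sigma; lra.
have := congr1 (@ln R) h3; rewrite lnM ?posrE ?expR_gt0// !expRK; lra.
Qed.

(** ln t - ln s > 1 - s/t = (t - s)/t >= t - s, the last because t <= 1. *)
Lemma subr1_ln_decr s t : 0 < s -> s < t -> t <= 1 ->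
  t - 1 - ln t < s - 1 - ln s.
Proof.
move=> s0 st t1; have t0 : 0 < t := lt_trans s0 st.
have st0 : 0 < s / t by rewrite divr_gt0.
have := @expR_gt1Dx R (ln s - ln t).
rewrite expRB !lnK ?posrE// => h.
have {}h : 1 + (ln s - ln t) < s / t.
  apply: h; rewrite -ln_quot// ln_eq0// lt_eqF// ltr_pdivrMr// mul1r.
  exact: st.
suff : (t - s) <= 1 - s / t by lra.
have -> : 1 - s / t = (t - s) / t by field; lra.
by rewrite ler_pdivlMr// ler_piMr//; lra.
Qed.

(** Turns a bound on a one-coordinate divergence into a lower bound on a ratio of coordinates. *)
Lemma sigma_le s t : 0 < s -> 0 <= t -> s - 1 - ln s <= t -> sigma t <= s.
Proof.
move=> s0 t0 st; have [g0 g1 ge] := sigmaP t0.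
by rewrite leNgt; apply/negP => /(subr1_ln_decr s0)/(_ g1); rewrite ge; lra.
Qed.

Lemma sigma_decr s t : 0 <= s -> s <= t -> sigma t <= sigma s.
Proof.
move=> s0 st; have [g0 g1 ge] := sigmaP s0.
by apply: sigma_le => //; [exact: le_trans st|rewrite ge].
Qed.

(** With r = sqrt(sigma), t = r^2 - 1 - 2 ln r >= (1 - r)^2 by ln r <= r - 1, so r >= 1 - sqrt t. *)
Lemma sigma_near1 t : 0 <= t -> 1 - 2 * Num.sqrt t <= sigma t.
Proof.
move=> t0; have [g0 g1 ge] := sigmaP t0.
set r := Num.sqrt (sigma t).
have r0 : 0 < r by rewrite sqrtr_gt0.
have rE : sigma t = r ^+ 2 by rewrite sqr_sqrtr ?ltW.
have r1 : r <= 1 by rewrite -sqrtr1 ler_wsqrtr.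
have tr : (1 - r) ^+ 2 <= t.
  have h1 := ln_leB1 r0; have h2 := lnXn 2 r0.
  move: ge; rewrite rE h2 => <-; lra.
have : 1 - r <= Num.sqrt t by rewrite -[1 - r]ger0_norm ?subr_ge0// -sqrtr_sqr ler_wsqrtr.
rewrite rE; nra.
Qed.
End lambert.

(** * Inner product of row vectors *)

Section row_dot.
Variables (R : realType).

(** Rows are used so that lying in the row space of [A] reads [(p <= A)%MS]. *)
Definition rdot n (u v : 'rV[R]_n) : R := (u *m v^T) 0 0.

Lemma rdotE n (u v : 'rV[R]_n) : rdot u v = \sum_i u 0 i * v 0 i.
Proof. by rewrite /rdot mxE; apply: eq_bigr => i _; rewrite mxE. Qed.

Lemma rdotC n (u v : 'rV[R]_n) : rdot u v = rdot v u.
Proof. by rewrite !rdotE; apply: eq_bigr => i _; rewrite mulrC. Qed.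

Lemma rdotDl n (u v w : 'rV[R]_n) : rdot (u + v) w = rdot u w + rdot v w.
Proof. by rewrite /rdot mulmxDl mxE. Qed.

Lemma rdotZl n a (u w : 'rV[R]_n) : rdot (a *: u) w = a * rdot u w.
Proof. by rewrite /rdot -scalemxAl mxE. Qed.

Lemma rdotDr n (u v w : 'rV[R]_n) : rdot w (u + v) = rdot w u + rdot w v.
Proof. by rewrite !(rdotC w) rdotDl. Qed.

Lemma rdotZr n a (u w : 'rV[R]_n) : rdot w (a *: u) = a * rdot w u.
Proof. by rewrite !(rdotC w) rdotZl. Qed.

Lemma rdot_mulmx m n (u : 'rV[R]_m) (v : 'rV[R]_n) (B : 'M[R]_(m, n)) :
  rdot (u *m B) v = rdot u (v *m B^T).
Proof. by rewrite /rdot trmx_mul trmxK mulmxA. Qed.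

Lemma rdot_ge0 n (u : 'rV[R]_n) : 0 <= rdot u u.
Proof. by rewrite rdotE sumr_ge0// => i _; rewrite -expr2 sqr_ge0. Qed.

Lemma rdot_eq0 n (u : 'rV[R]_n) : (rdot u u == 0) = (u == 0).
Proof.
apply/idP/eqP => [|->]; last by rewrite /rdot mul0mx mxE.
rewrite rdotE psumr_eq0 => [/allP h|i _]; last by rewrite -expr2 sqr_ge0.
apply/rowP => i; apply/eqP; rewrite mxE -sqrf_eq0 expr2.
by apply: h; rewrite mem_index_enum.
Qed.

Lemma rdot_gt0 n (u : 'rV[R]_n) : (0 < rdot u u) = (u != 0).
Proof. by rewrite lt_def rdot_ge0 andbT rdot_eq0. Qed.

Lemma rdot_cauchy_schwarz n (u v : 'rV[R]_n) : rdot u v ^+ 2 <= rdot u u * rdot v v.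
Proof.
have [->|v0] := eqVneq v 0; first by rewrite /rdot trmx0 !mulmx0 !mxE expr0n mulr0.
have V0 : 0 < rdot v v by rewrite rdot_gt0.
(* Expand the squared norm of |v|^2 u - <u, v> v. *)
have := rdot_ge0 (rdot v v *: u + (- rdot u v) *: v).
rewrite rdotDl !rdotDr !rdotZl !rdotZr (rdotC v u).
set a := rdot u u; set b := rdot u v; set c := rdot v v.
rewrite -/c in V0.
have -> : c * (c * a) + c * (- b * b) + (- b * (c * b) + - b * (- b * c)) =
  c * (a * c - b ^+ 2) by ring.
by rewrite pmulr_rge0// subr_ge0.
Qed.

(** First-order condition: at t = -a / (1 + |k|) the linear term outweighs the quadratic one,
    whatever the sign of k. *)
Lemma linear_term_eq0 (a k : R) : (forall t, 0 <= 2 * t * a + t ^+ 2 * k) -> a = 0.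
Proof.
move=> h; apply/eqP; apply: contraT => a0.
have k0 : 0 < 1 + `|k| by rewrite ltr_pwDl.
have := h (- a / (1 + `|k|)).
have -> : 2 * (- a / (1 + `|k|)) * a + (- a / (1 + `|k|)) ^+ 2 * k =
  (a / (1 + `|k|)) ^+ 2 * (k - 2 * (1 + `|k|)).
  by field; rewrite gt_eqF.
have a2 : 0 < (a / (1 + `|k|)) ^+ 2.
  by rewrite exprn_even_gt0//= mulf_neq0// invr_neq0 ?gt_eqF.
rewrite pmulr_rge0//; have := ler_norm k; lra.
Qed.

Lemma cvg_sumr (T : Type) (F : set_system T) (FF : Filter F) (I : finType)
    (f : I -> T -> R) (l : I -> R) :
  (forall i, f i x @[x --> F] --> l i) ->
  (\sum_i f i x) @[x --> F] --> \sum_i l i.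
Proof. by move=> fl; apply: cvg_big => // x; exact: add_continuous. Qed.

Lemma continuous_rdot m n (B : 'M[R]_(m, n)) :
  continuous (fun u : 'rV[R]_m => rdot (u *m B) (u *m B)).
Proof.
have cu j : continuous (fun u : 'rV[R]_m => (u *m B) 0 j).
  have -> : (fun u : 'rV[R]_m => (u *m B) 0 j) = fun u => \sum_i u 0 i * B i j.
    by apply/funext => u; rewrite mxE.
  move=> u; apply: (@cvg_sumr _ (nbhs u) _ _ (fun i (w : 'rV[R]_m) => w 0 i * B i j)) => i.
  by apply: cvgM; [exact: coord_continuous|exact: cvg_cst].
have -> : (fun u : 'rV[R]_m => rdot (u *m B) (u *m B)) =
    fun u => \sum_j (u *m B) 0 j * (u *m B) 0 j.
  by apply/funext => u; rewrite rdotE.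
move=> u; apply: (@cvg_sumr _ (nbhs u) _ _ (fun j (w : 'rV[R]_m) => (w *m B) 0 j * (w *m B) 0 j)) => j; apply: cvgM; exact: cu.
Qed.

End row_dot.

(** * The smallest positive eigenvalue as a Rayleigh minimum over the row space *)

Section smallest_positive_eigenvalue.
Variables (R : realType) (m n : nat) (A : 'M[R]_(m, n)).

(** A row w = y A with w A^T = 0 has |w|^2 = <y, w A^T> = 0, so the two spaces meet in 0, and their
    ranks add up to n. *)
Lemma row_kernel_decomp (u : 'rV[R]_n) :
  exists p q : 'rV[R]_n, [/\ u = p + q, (p <= A)%MS & q *m A^T = 0].
Proof.
have cap0 : (A :&: kermx A^T)%MS = 0.
  apply/eqP; rewrite -submx0; apply/rV_subP => w; rewrite sub_capmx.
  move=> /andP[/submxP[y yE] /sub_kermxP wA].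
  rewrite submx0 -rdot_eq0 {1}yE rdot_mulmx wA.
  by rewrite /rdot trmx0 mulmx0 mxE.
have full : row_full (A + kermx A^T)%MS.
  rewrite /row_full (mxrank_disjoint_sum cap0) mxrank_ker mxrank_tr.
  by rewrite subnKC// rank_leq_col.
have /sub_addsmxP[[y w] /= uE] := submx_full u full.
exists (y *m A), (w *m kermx A^T); split => //; first exact: submxMl.
by rewrite -mulmxA mulmx_ker mulmx0.
Qed.

Let q (u : 'rV[R]_n) := rdot (u *m A^T) (u *m A^T).

(** The unit sphere of the row space is compact, so [q] attains its minimum there; homogeneity
    extends the bound to every p. *)
Lemma rayleigh_min : A != 0 -> exists c : 'rV[R]_n,
  [/\ c != 0, (c <= A)%MS, rdot c c = 1 &
      forall p, (p <= A)%MS -> q c * rdot p p <= q p].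
Proof.
move=> A0; pose S := [set u : 'rV[R]_n | (u <= A)%MS /\ rdot u u = 1].
have nrm (p : 'rV[R]_n) : (p <= A)%MS -> p != 0 -> S ((Num.sqrt (rdot p p))^-1 *: p).
  move=> pA p0; split; first exact: scalemx_sub.
  rewrite rdotZl rdotZr mulrA -expr2 exprVn sqr_sqrtr ?rdot_ge0//.
  by rewrite mulVf// rdot_eq0.
have S0 : S !=set0.
  have /rowV0Pn[p pA p0] := A0.
  by eexists; exact: nrm pA p0.
have cS : compact S.
  apply: bounded_closed_compact.
    exists 1; split => // M M1 u [_ u1].
    apply: le_trans (ltW M1).
    rewrite [leLHS]/Num.Def.normr /= mx_normrE; apply: bigmax_le => //= -[i j] _ /=.
    rewrite -(ler_pXn2r (n := 2)) ?nnegrE// expr1n real_normK ?num_real//.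
    rewrite ord1 -u1 rdotE (bigD1 j)//= -expr2 lerDl sumr_ge0// => k _.
    by rewrite -expr2 sqr_ge0.
  (* Closedness: both conditions become preimages of points under continuous maps, the row space
     being where u times [cokermx A] vanishes. *)
  have -> : S = (fun u => rdot (u *m cokermx A) (u *m cokermx A)) @^-1` [set 0] `&`
      (fun u => rdot (u *m 1%:M) (u *m 1%:M)) @^-1` [set 1].
    rewrite /S; apply/seteqP; split => u /=; rewrite mulmx1 submxE => -[h1 h2]; split => //.
      by apply/eqP; rewrite rdot_eq0.
    by rewrite -rdot_eq0 h1.
  apply: closedI; apply: preimage_closed => // u _; exact: continuous_rdot.
have [c /set_mem[cA c1] cmin] := EVT_min_rV S0 cS (continuous_subspaceT (@continuous_rdot R _ _ A^T)).
exists c; split => //.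
  by rewrite -rdot_gt0 c1.
move=> p pA; have [->|p0] := eqVneq p 0.
  by rewrite /q mul0mx /rdot !mul0mx !mxE mulr0.
have := cmin _ (mem_set (nrm p pA p0)).
have N0 : 0 < rdot p p by rewrite rdot_gt0.
rewrite -scalemxAl rdotZl rdotZr mulrA -expr2 exprVn sqr_sqrtr ?rdot_ge0//.
by rewrite -/(q _) -/(q _) mulrC ler_pdivlMr.
Qed.

(** The constrained minimiser c is an eigenvector for [q c], and every eigenvector with positive
    eigenvalue lies in the row space, so [q c] is the smallest positive eigenvalue. *)
Lemma lambda_min_posP : A != 0 ->
  0 < lambda_min_pos (A^T *m A) /\
  forall p, (p <= A)%MS -> lambda_min_pos (A^T *m A) * rdot p p <= q p.
Proof.
move=> A0; have [c [c0 cA c1 cmin]] := rayleigh_min A0.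
have qE u : q u = rdot (u *m (A^T *m A)) u.
  by rewrite /q mulmxA [RHS]rdot_mulmx.
have qc0 : 0 < q c.
  rewrite /q rdot_gt0; apply: contra c0 => /eqP cA0; case/submxP: cA => y yE.
  by rewrite -rdot_eq0 {1}yE rdot_mulmx cA0 /rdot trmx0 mulmx0 mxE.
(* Minimality along c + t w makes a quadratic in t nonnegative, so its linear coefficient
   vanishes. *)
have ortho w : (w <= A)%MS -> rdot (c *m A^T) (w *m A^T) = q c * rdot c w.
  move=> wA; apply/eqP; rewrite -subr_eq0; apply/eqP.
  apply: (@linear_term_eq0 _ _ (q w - q c * rdot w w)) => t.
  have := cmin (c + t *: w) (addmx_sub cA (scalemx_sub _ wA)).
  rewrite {2}/q !mulmxDl -!scalemxAl !rdotDl !rdotDr !rdotZl !rdotZr.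
  rewrite -/(q c) -/(q w) (rdotC w c) (rdotC (w *m _) (c *m _)) c1; lra.
have cev : c *m (A^T *m A) = q c *: c.
  (* This residual lies in the row space and is orthogonal to it, hence is zero. *)
  pose w := c *m (A^T *m A) - q c *: c.
  have wA : (w <= A)%MS.
    by rewrite addmx_sub// ?mulmxA ?submxMl// -scaleNr scalemx_sub.
  apply/eqP; rewrite -subr_eq0 -/w -rdot_eq0 {1}/w rdotDl -scaleNr rdotZl mulNr.
  by rewrite mulmxA rdot_mulmx ortho// subrr.
have qmin a : eigenvalue (A^T *m A) a -> 0 < a -> q c <= a.
  move=> /eigenvalueP[v vE v0] a0.
  have vA : (v <= A)%MS.
    have -> : v = a^-1 *: (v *m A^T *m A).
      by rewrite -mulmxA vE scalerA mulVf ?scale1r ?gt_eqF.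
    by rewrite scalemx_sub ?submxMl.
  have := cmin v vA; rewrite (qE v) vE rdotZl ler_pM2r// rdot_gt0//.
suff -> : lambda_min_pos (A^T *m A) = q c by [].
rewrite /lambda_min_pos; case: xgetP => [a -> [aev [a0 amin]]|/(_ (q c))[]].
  apply/eqP; rewrite eq_le qmin// andbT; apply: amin => //.
  by apply/eigenvalueP; exists c.
by split; [apply/eigenvalueP; exists c|split].
Qed.

(** The kernel component of u contributes neither to <u, d> nor to [q u]; Cauchy-Schwarz handles the
    row component. *)
Lemma lambda_min_pos_dual (u d : 'rV[R]_n) : A != 0 ->
  (forall v, v *m A^T = 0 -> rdot v d = 0) ->
  lambda_min_pos (A^T *m A) * rdot u d ^+ 2 <= q u * rdot d d.
Proof.
move=> A0 dker; have [l0 lmin] := lambda_min_posP A0.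
have [p [k [uE pA kA]]] := row_kernel_decomp u.
have -> : rdot u d = rdot p d by rewrite uE rdotDl (dker k kA) addr0.
have -> : q u = q p by rewrite /q uE mulmxDl kA addr0.
apply: le_trans (ler_wpM2r (rdot_ge0 d) (lmin p pA)).
by rewrite -mulrA ler_pM2l// rdot_cauchy_schwarz.
Qed.

End smallest_positive_eigenvalue.

(** * Bounds through column norms and the maximum norm *)

Section vector_bounds.
Variables (R : realType) (m n : nat) (A : 'M[R]_(m, n)).

(** Positivity excludes the default value 0 of [xget]. *)
Lemma vmin_le (z : 'cV[R]_n) : 0 < vmin z -> forall i, vmin z <= z i 0.
Proof. by rewrite /vmin; case: xgetP => [a -> []//|_]; rewrite ltxx. Qed.

Lemma sum_cauchy_schwarz k (a c : 'I_k -> R) :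
  (\sum_i a i * c i) ^+ 2 <= (\sum_i a i ^+ 2) * \sum_i c i ^+ 2.
Proof.
have := rdot_cauchy_schwarz (\row_i a i) (\row_i c i); rewrite !rdotE.
under eq_bigr do rewrite !mxE.
under [X in _ <= X * _ -> _]eq_bigr do rewrite !mxE -expr2.
by under [X in _ <= _ * X -> _]eq_bigr do rewrite !mxE -expr2.
Qed.

Lemma col_sqnorm_le j : \sum_i A i j ^+ 2 <= max_col_sqnorm A.
Proof. exact: (le_bigmax _ (fun j => \sum_i A i j ^+ 2)). Qed.

Lemma max_col_sqnorm_gt0 : A != 0 -> 0 < max_col_sqnorm A.
Proof.
move=> A0; have [i [j Aij]] : exists i j, A i j != 0.
  apply/not_existsP => h; move/eqP: A0; apply; apply/matrixP => i j.
  rewrite mxE; apply/eqP; apply: contraT => Aij; exfalso.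
  by apply: (h i); exists j.
apply: lt_le_trans (col_sqnorm_le j); rewrite (bigD1 i)//=.
by rewrite ltr_wpDr ?exprn_even_gt0// sumr_ge0// => k _; exact: sqr_ge0.
Qed.

Lemma gram_entry_le j l : `|(A^T *m A) j l| <= max_col_sqnorm A.
Proof.
have M0 : 0 <= max_col_sqnorm A.
  by apply: le_trans (col_sqnorm_le j); rewrite sumr_ge0// => k _; exact: sqr_ge0.
rewrite -(ler_pXn2r (n := 2)) ?nnegrE// real_normK ?num_real// mxE.
under eq_bigr do rewrite mxE.
apply: le_trans (sum_cauchy_schwarz _ _) _; rewrite [leRHS]expr2.
by rewrite ler_pM ?col_sqnorm_le// sumr_ge0// => k _; exact: sqr_ge0.
Qed.

Lemma inf_norm_ge (v : 'cV[R]_n) i : `|v i 0| <= inf_norm v.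
Proof. exact: (le_bigmax _ (fun i => `|v i 0|)). Qed.

Lemma inf_norm_ge0 (v : 'cV[R]_n) : 0 <= inf_norm v.
Proof. exact: bigmax_ge_id. Qed.

End vector_bounds.

(** * One step of mirror descent *)

Section step.
Variables (R : realType) (m n : nat) (A : 'M[R]_(m, n)) (b : 'cV[R]_m).
Variables (z x : 'cV[R]_n).
Hypothesis A0 : A != 0.
Hypothesis Az : A *m z = b.
Hypothesis x_gt0 : forall i, 0 < x i 0.
Hypothesis zmin_gt0 : 0 < vmin z.

Let g := lsq_grad A b x.
Let f := lsq A b x.
Let M := max_col_sqnorm A.
Let S := l1_norm x + l1_norm z.
Let alpha := polyak_step A b x.
Let D := Dh z x.

Lemma vmin_coord_gt0 i : 0 < z i 0.
Proof. exact: lt_le_trans (vmin_le zmin_gt0 i). Qed.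

Lemma l1_norm_pos (v : 'cV[R]_n) : (forall i, 0 < v i 0) ->
  l1_norm v = \sum_i v i 0.
Proof. by move=> v0; apply: eq_bigr => i _; rewrite gtr0_norm. Qed.

Lemma residualE : A *m x - b = A *m (x - z).
Proof. by rewrite mulmxBr Az. Qed.

Lemma lsq_ge0 : 0 <= f.
Proof. by rewrite mulr_ge0// sumr_ge0// => i _; exact: sqr_ge0. Qed.

Lemma double_lsqE : 2 * f = \sum_i ((A *m x - b) i 0) ^+ 2.
Proof. by rewrite /f /lsq mulrA divff ?mul1r. Qed.

Lemma grad_dot : \sum_i g i 0 * (x i 0 - z i 0) = 2 * f.
Proof.
transitivity ((g^T *m (x - z)) 0 0).
  by rewrite mxE; apply: eq_bigr => i _; rewrite !mxE.
rewrite /g /lsq_grad trmx_mul trmxK -mulmxA -residualE mxE.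
rewrite double_lsqE.
by apply: eq_bigr => i _; rewrite mxE -expr2.
Qed.

Lemma grad_sqr_le i : g i 0 ^+ 2 <= M * (2 * f).
Proof.
rewrite /g /lsq_grad mxE; under eq_bigr do rewrite mxE.
apply: le_trans (sum_cauchy_schwarz _ _) _.
rewrite double_lsqE ler_wpM2r ?col_sqnorm_le//.
by rewrite sumr_ge0// => k _; exact: sqr_ge0.
Qed.

Lemma lnorm2_grad_le : lnorm2 x g <= 2 * M * S * f.
Proof.
have M0 := max_col_sqnorm_gt0 A0; have f0 := lsq_ge0.
apply: (@le_trans _ _ (l1_norm x * (M * (2 * f)))).
  rewrite l1_norm_pos// mulr_suml; apply: ler_sum => i _.
  by rewrite ler_wpM2l ?grad_sqr_le// ltW.
have -> : 2 * M * S * f = S * (M * (2 * f)) by ring.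
apply: ler_wpM2r; first exact: mulr_ge0 (ltW M0) (mulr_ge0 _ f0).
by rewrite lerDl sumr_ge0.
Qed.

(** Since A z = b, the gradient is A^T A (x - z), and the Gram entries are at most [M]. *)
Lemma inf_norm_grad_le : inf_norm g <= M * S.
Proof.
have M0 := max_col_sqnorm_gt0 A0.
have S0 : 0 <= S by rewrite addr_ge0 ?sumr_ge0.
apply: bigmax_le => [|i _]; first exact: mulr_ge0 (ltW M0) S0.
rewrite /g /lsq_grad residualE mulmxA mxE.
apply: le_trans (ler_norm_sum _ _ _) _.
rewrite /S /l1_norm -big_split/= mulr_sumr; apply: ler_sum => j _.
rewrite normrM ler_pM ?gram_entry_le// !mxE.
exact: ler_normB.
Qed.

Lemma polyak_step_ge0 : 0 <= alpha.
Proof.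
rewrite le_min !divr_ge0 ?lsq_ge0 ?inf_norm_ge0//.
by rewrite sumr_ge0// => i _; rewrite mulr_ge0 ?sqr_ge0// ltW.
Qed.

Lemma polyak_step_cap i : - (alpha * g i 0) <= 179 / 100.
Proof.
(* For g = 0 the denominator cannot be cancelled, but then the left side is 0. *)
have [I0|I0] := leP (inf_norm g) 0.
  have -> : g i 0 = 0.
    by apply/eqP; rewrite -normr_le0 (le_trans (inf_norm_ge g i)).
  by rewrite mulr0 oppr0; lra.
have h : alpha <= 179 / 100 / inf_norm g by rewrite ge_min lexx orbT.
apply: le_trans (ler_norm _) _; rewrite normrN normrM ger0_norm ?polyak_step_ge0//.
apply: le_trans (ler_pM polyak_step_ge0 (normr_ge0 _) h (inf_norm_ge g i)) _.
by rewrite divfK ?gt_eqF.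
Qed.

Lemma polyak_step_lnorm2 : alpha * lnorm2 x g <= f.
Proof.
have [L0|L0] := leP (lnorm2 x g) 0.
  apply: le_trans lsq_ge0; rewrite mulr_ge0_le0// ?polyak_step_ge0//.
by rewrite -ler_pdivlMr// ge_min lexx.
Qed.

(** A nonzero gradient keeps both denominators positive. The first term of the minimum dictates the
    factor 2; the cap alone would allow 1.79 / (M S). *)
Lemma polyak_step_lower : g != 0 -> 1 <= 2 * M * S * alpha.
Proof.
move=> gn0.
have [i gi] : exists i, g i 0 != 0.
  apply/not_existsP => h; move/eqP: gn0; apply; apply/colP => i.
  rewrite [RHS]mxE; apply/eqP; apply: contraT => gi; exfalso.
  exact: (h i gi).
have I0 : 0 < inf_norm g.
  by apply: lt_le_trans (inf_norm_ge g i); rewrite normr_gt0.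
have L0 : 0 < lnorm2 x g.
  rewrite /lnorm2 (bigD1 i)//= ltr_wpDr//.
    by rewrite sumr_ge0// => k _; rewrite mulr_ge0 ?sqr_ge0// ltW.
  by rewrite mulr_gt0// exprn_even_gt0.
have MS0 : 0 < M * S by exact: lt_le_trans inf_norm_grad_le.
have K0 : 0 < 2 * M * S by rewrite -mulrA mulr_gt0.
rewrite -ler_pdivrMl// mulr1 le_min; apply/andP; split.
  by rewrite ler_pdivlMr// ler_pdivrMl// lnorm2_grad_le.
rewrite ler_pdivlMr// ler_pdivrMl//.
by apply: le_trans inf_norm_grad_le _; lra.
Qed.

(** The successor case of [emd], to which [emd A b x0 k.+1] is convertible. *)
Definition emd_step (y : 'cV[R]_n) : 'cV[R]_n :=
  \col_i (y i 0 * expR (- (polyak_step A b y * lsq_grad A b y i 0))).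

Lemma Dh_step : Dh z (emd_step x) <= D - 2 / 3 * (alpha * f).
Proof.
have h : Dh z (emd_step x) <=
    D - alpha * (2 * f) + 4 / 3 * alpha ^+ 2 * lnorm2 x g.
  rewrite -grad_dot /D /Dh /lnorm2 !mulr_sumr -sumrB -big_split /=.
  apply: ler_sum => i _; rewrite mxE -/g -/alpha.
  have x0 := x_gt0 i; have z0 := vmin_coord_gt0 i.
  have := expR_le_quadratic (polyak_step_cap i).
  rewrite !ln_quot ?mulr_gt0 ?expR_gt0// lnM ?posrE ?expR_gt0// expRK => e.
  have := ler_wpM2l (ltW x0) e; lra.
(* Since alpha ||g||_x^2 <= f, the last two terms add up to at most (-2 + 4/3) alpha f. *)
have := polyak_step_lnorm2; have := polyak_step_ge0.
move=> a0 aL; have := ler_wpM2l a0 aL; lra.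
Qed.

Lemma Dh_ge0 : 0 <= D.
Proof. by rewrite sumr_ge0// => i _; rewrite dent_ge0// vmin_coord_gt0. Qed.

Lemma l1_norm_le : S <= 8 / 3 * (l1_norm z + D).
Proof.
have h : l1_norm x <= 5 / 3 * l1_norm z + 8 / 3 * D.
  rewrite !l1_norm_pos//; last exact: vmin_coord_gt0.
  rewrite /D /Dh !mulr_sumr -big_split/=; apply: ler_sum => i _.
  by rewrite dent_mass// vmin_coord_gt0.
rewrite /S; lra.
Qed.

Let s := sigma (D / vmin z).

Lemma D_zmin_ge0 : 0 <= D / vmin z.
Proof. by rewrite divr_ge0 ?Dh_ge0 ?ltW. Qed.

(** With r = x_i / z_i, the i-th term of D is z_i (r - 1 - ln r), so r - 1 - ln r <= D / z_i <= D /
    z_min. *)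
Lemma coord_ge_sigma i : s * z i 0 <= x i 0.
Proof.
have x0 := x_gt0 i; have z0 := vmin_coord_gt0 i.
rewrite -ler_pdivlMr//; apply: sigma_le; rewrite ?divr_gt0 ?D_zmin_ge0//.
have h : dent (z i 0) (x i 0) <= D.
  rewrite /D /Dh (bigD1 i)//= lerDl sumr_ge0// => j _.
  by rewrite dent_ge0 ?vmin_coord_gt0.
apply: (@le_trans _ _ (D / z i 0)); last first.
  by rewrite ler_wpM2l ?Dh_ge0// lef_pV2 ?posrE// vmin_le.
rewrite ler_pdivlMr//; apply: le_trans h.
rewrite /dent !ln_quot// le_eqVlt; apply/orP; left; apply/eqP.
by field; rewrite gt_eqF.
Qed.

(* Polyak-Lojasiewicz inequality: in the dual variable ln x, the function D_h(z, .) has gradient x - z and is strongly convex with modulus s * vmin z on the segment from ln x to ln z, which is parallel to the row space of A. *)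
Lemma Dh_le_lsq :
  (forall v : 'cV[R]_n, A *m v = 0 -> \sum_i v i 0 * (ln (x i 0) - ln (z i 0)) = 0) ->
  lambda_min_pos (A^T *m A) * vmin z * s * D <= f.
Proof.
move=> ker; set l := lambda_min_pos _.
have [l0 _] := lambda_min_posP A0; rewrite -/l in l0.
have [s0 s1 _] := sigmaP D_zmin_ge0; rewrite -/s in s0 s1.
pose d : 'cV[R]_n := \col_i (ln (x i 0) - ln (z i 0)).
set mu := vmin z * s.
have mu0 : 0 < mu by rewrite mulr_gt0.
pose p := \sum_i (x i 0 - z i 0) * d i 0.
pose N := \sum_i d i 0 ^+ 2.
(* The symmetrised divergence gives D_h(z, x) = p - D_h(x, z), and D_h(x, z) >= mu N / 2. *)
have Dp : D <= p - mu / 2 * N.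
  rewrite /D /p /N /Dh mulr_sumr -sumrB; apply: ler_sum => i _.
  have x0 := x_gt0 i; have z0 := vmin_coord_gt0 i; have zm := vmin_le zmin_gt0 i.
  have := dent_sum x0 z0.
  have mx : mu <= x i 0.
    by apply: le_trans (coord_ge_sigma i); rewrite /mu mulrC ler_wpM2l// ltW.
  have mz : mu <= z i 0.
    by apply: le_trans zm; rewrite /mu ler_piMr// ltW.
  have := dent_ge_sqr_ln x0 z0 mx mz; rewrite mxE /dent; lra.
have pN : l * p ^+ 2 <= 2 * f * N.
  have := @lambda_min_pos_dual R m n A (x - z)^T d^T A0.
  have -> : rdot (x - z)^T d^T = p.
    by rewrite rdotE; apply: eq_bigr => i _; rewrite !mxE.
  have -> : rdot d^T d^T = N.
    by rewrite rdotE; apply: eq_bigr => i _; rewrite !mxE expr2.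
  have -> : rdot ((x - z)^T *m A^T) ((x - z)^T *m A^T) = 2 * f.
    rewrite -trmx_mul -residualE rdotE double_lsqE.
    by apply: eq_bigr => i _; rewrite mxE -expr2.
  apply=> v vA; rewrite rdotE -[RHS](ker v^T); last first.
    by rewrite -[A]trmxK -trmx_mul vA trmx0.
  by apply: eq_bigr => i _; rewrite !mxE.
have N0 : 0 <= N by rewrite sumr_ge0// => i _; exact: sqr_ge0.
have lm0 : 0 < l * mu by rewrite mulr_gt0.
rewrite -(mulrA l) -/mu.
apply: le_trans (ler_wpM2l (ltW lm0) Dp) _.
have f0 := lsq_ge0.
(* AM-GM, compared on squares: (l mu p)^2 <= 4 f (l mu^2 N / 2) <= (f + l mu^2 N / 2)^2. *)
suff : l * mu * p <= f + l * mu ^+ 2 / 2 * N by lra.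
apply: le_trans (ler_norm _) _.
have R0 : 0 <= l * mu ^+ 2 / 2 * N by rewrite !mulr_ge0 ?sqr_ge0// ltW.
rewrite -(ler_pXn2r (n := 2)) ?nnegrE ?addr_ge0// real_normK ?num_real//.
have := ler_wpM2l (_ : 0 <= l * mu ^+ 2) pN.
have -> : l * mu ^+ 2 * (l * p ^+ 2) = (l * mu * p) ^+ 2 by ring.
move=> h; apply: le_trans (h _) _; first by rewrite mulr_ge0 ?sqr_ge0// ltW.
rewrite -subr_ge0.
have -> : (f + l * mu ^+ 2 / 2 * N) ^+ 2 - l * mu ^+ 2 * (2 * f * N) =
  (f - l * mu ^+ 2 / 2 * N) ^+ 2 by field.
exact: sqr_ge0.
Qed.

Lemma rateE (t : R) : rate A z t =
  1 - lambda_min_pos (A^T *m A) * vmin z * sigma (t / vmin z) /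
      (8 * M * (l1_norm z + t)).
Proof. by rewrite /rate /sigma !mulrN !mulNr. Qed.

(** A nonzero matrix has at least one column. *)
Lemma l1_norm_z_gt0 : 0 < l1_norm z.
Proof.
have [i0] : exists i : 'I_n, True.
  case: n A A0 => [B|k _ _]; last by exists ord0.
  by rewrite (_ : B = 0) ?eqxx//; apply/matrixP => i; case.
move=> _; rewrite (l1_norm_pos vmin_coord_gt0) (bigD1 i0)//= ltr_wpDr ?vmin_coord_gt0//.
by rewrite sumr_ge0// => j _; rewrite ltW// vmin_coord_gt0.
Qed.

Lemma rate_le (t u : R) : 0 <= t -> t <= u -> rate A z t <= rate A z u.
Proof.
move=> t0 tu; rewrite !rateE lerD2l lerN2.
have [l0 _] := lambda_min_posP A0; have M0 := max_col_sqnorm_gt0 A0.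
have z0 := l1_norm_z_gt0.
have tz0 : 0 <= t / vmin z := divr_ge0 t0 (ltW zmin_gt0).
have tuz : t / vmin z <= u / vmin z by rewrite ler_wpM2r// invr_ge0 ltW.
have [s0 _ _] := sigmaP (le_trans tz0 tuz).
have lz0 : 0 < lambda_min_pos (A^T *m A) * vmin z by rewrite mulr_gt0.
have K0 (y : R) : 0 <= y -> 0 < 8 * M * (l1_norm z + y).
  by move=> y0; rewrite !mulr_gt0//; lra.
have u0 := le_trans t0 tu.
apply: ler_pM.
- exact: mulr_ge0 (ltW lz0) (ltW s0).
- by rewrite invr_ge0 ltW// K0.
- by rewrite ler_wpM2l ?sigma_decr// ltW.
rewrite lef_pV2 ?posrE ?K0//; apply: ler_wpM2l; last by lra.
by rewrite mulr_ge0// ltW.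
Qed.

Lemma Dh_step_rate :
  (forall v : 'cV[R]_n, A *m v = 0 -> \sum_i v i 0 * (ln (x i 0) - ln (z i 0)) = 0) ->
  Dh z (emd_step x) <= D * rate A z D.
Proof.
move=> ker; have := Dh_le_lsq ker; rewrite rateE -/s.
have [l0 _] := lambda_min_posP A0; have M0 : 0 < M := max_col_sqnorm_gt0 A0.
have z0 := l1_norm_z_gt0; have D0 := Dh_ge0.
have [s0 _ _] := sigmaP D_zmin_ge0; rewrite -/s in s0.
set c := lambda_min_pos _ * vmin z * s => cf.
have c0 : 0 < c by rewrite !mulr_gt0.
apply: le_trans Dh_step _; rewrite mulrBr mulr1 lerD2l lerN2.
rewrite mulrA ler_pdivrMr ?mulr_gt0//; last by lra.
have [g0|gn0] := eqVneq g 0.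
  have f0 : f = 0.
    have := grad_dot; rewrite g0 big1 => [|i _]; first by lra.
    by rewrite mxE mul0r.
  have -> : D = 0.
    by apply/eqP; rewrite eq_le D0 andbT -(pmulr_rle0 _ c0) -f0.
  by rewrite f0 mulr0 mulr0 !mul0r.
have h1 := polyak_step_lower gn0.
have h2 := l1_norm_le.
have a0 := polyak_step_ge0; have f0 := lsq_ge0.
(* Chain c D <= f <= 2 M S alpha f <= (16/3) M (||z||_1 + D) alpha f; the constant 8 arises from
   16/3 = (2/3) 8. *)
apply: (@le_trans _ _ f); first by rewrite mulrC.
apply: (@le_trans _ _ (2 * M * S * alpha * f)); first by rewrite ler_peMl.
have : (M * alpha * f) * S <= (M * alpha * f) * (8 / 3 * (l1_norm z + D)).
  by apply: ler_wpM2l h2; exact: mulr_ge0 (mulr_ge0 (ltW M0) a0) f0.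
lra.
Qed.

End step.

(** * The iterates in the dual variable and their limit *)

Section iterates.
Variables (R : realType) (m n : nat) (A : 'M[R]_(m, n)) (b : 'cV[R]_m).
Variables (x0 z : 'cV[R]_n).
Hypothesis x0_gt0 : forall i, 0 < x0 i 0.

Let x k := emd A b x0 k.

Lemma emd_gt0 k i : 0 < x k i 0.
Proof. by elim: k => [|k ih] //=; rewrite mxE mulr_gt0 ?expR_gt0. Qed.

(** Each step subtracts from ln x_k a multiple of A^T (A x_k - b), which is orthogonal to the kernel
    of A. *)
Lemma emd_ln_invariant (v : 'cV[R]_n) k : A *m v = 0 ->
  \sum_i v i 0 * ln (x k i 0) = \sum_i v i 0 * ln (x0 i 0).
Proof.
move=> Av; elim: k => // k <-; rewrite /x /= -/(x k).
set a := polyak_step _ _ _; set g := lsq_grad _ _ _.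
have vg : \sum_i v i 0 * g i 0 = 0.
  transitivity ((v^T *m g) 0 0).
    by rewrite mxE; apply: eq_bigr => i _; congr (_ * _); rewrite mxE.
  by rewrite /g /lsq_grad mulmxA -trmx_mul Av trmx0 mul0mx mxE.
under eq_bigr => i _.
  rewrite mxE lnM ?posrE ?expR_gt0 ?emd_gt0// expRK.
  rewrite (_ : _ * _ = v i 0 * ln (x k i 0) - a * (v i 0 * g i 0)); last by ring.
  over.
by rewrite sumrB -mulr_sumr vg mulr0 subr0.
Qed.

Hypothesis z_gt0 : forall i, 0 < z i 0.
Hypothesis x_cvg : forall i, x k i 0 @[k --> \oo] --> z i 0.

Lemma cvg_ln_emd i : ln (x k i 0) @[k --> \oo] --> ln (z i 0).
Proof. by apply: continuous_cvg => //; exact: continuous_ln. Qed.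

(** The pairing of v with ln x_k is constant in k, so it equals its limit. *)
Lemma emd_ln_orthogonal (v : 'cV[R]_n) k : A *m v = 0 ->
  \sum_i v i 0 * (ln (x k i 0) - ln (z i 0)) = 0.
Proof.
move=> Av; under eq_bigr do rewrite mulrBr.
rewrite sumrB emd_ln_invariant//; apply/eqP; rewrite subr_eq0; apply/eqP.
have h : \sum_i v i 0 * ln (x k i 0) @[k --> \oo] --> \sum_i v i 0 * ln (z i 0).
  apply: (@cvg_sumr _ _ _ _ _ (fun i k => v i 0 * ln (x k i 0))) => i.
  by apply: cvgM; [exact: cvg_cst|exact: cvg_ln_emd].
move: h; under eq_cvg do rewrite emd_ln_invariant//.
by move=> h; exact: cvg_unique (cvg_cst _) h.
Qed.

Lemma Dh_emd_cvg0 : Dh z (x k) @[k --> \oo] --> (0 : R).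
Proof.
have -> : 0 = \sum_i (z i 0 * (ln (z i 0) - ln (z i 0)) - z i 0 + z i 0).
  by rewrite big1// => i _; rewrite subrr mulr0 sub0r addNr.
rewrite /Dh.
apply: (@cvg_sumr _ _ _ _ _ (fun i k => z i 0 * ln (z i 0 / x k i 0) - z i 0 + x k i 0)) => i.
apply: cvgD; last exact: x_cvg.
apply: cvgB; last exact: cvg_cst.
apply: cvgM; first exact: cvg_cst.
under eq_cvg do rewrite ln_quot ?emd_gt0//.
by apply: cvgB; [exact: cvg_cst|exact: cvg_ln_emd].
Qed.

End iterates.

(** * Limit of the rate and the theorem *)

Lemma cvg_sigma (R : realType) (u : nat -> R) :
  (forall k, 0 <= u k) -> u k @[k --> \oo] --> (0 : R) ->
  sigma (u k) @[k --> \oo] --> (1 : R).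
Proof.
move=> u0 ucvg.
(* The lower bound [sigma_near1] stands in for continuity of W_0 at its branch point -1/e. *)
apply: (@squeeze_cvgr _ _ _ _ (fun k => 1 - 2 * Num.sqrt (u k)) (fun=> 1)).
- near=> k; have [_ -> _] := sigmaP (u0 k).
  by rewrite sigma_near1.
- rewrite -[X in _ --> X](_ : 1 - 2 * Num.sqrt 0 = 1); last first.
    by rewrite sqrtr0 mulr0 subr0.
  apply: cvgB; first exact: cvg_cst.
  apply: cvgM; first exact: cvg_cst.
  apply: continuous_cvg => //; exact: sqrt_continuous.
- exact: cvg_cst.
Unshelve. all: by end_near. Qed.

Theorem theorem3p8 (R : realType) (m n : nat) (A : 'M[R]_(m, n)) (b : 'cV[R]_m)
  (x0 z : 'cV[R]_n) :
  A != 0 ->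
  Splus A b !=set0 ->
  (forall i, 0 < x0 i 0) ->
  z \in Splus A b ->
  (forall x, x \in Splus A b -> Dh z x0 <= Dh x x0) ->
  (forall i, (fun k : nat => (emd A b x0 k i 0 : R)) @ \oo --> (z i 0 : R)) ->
  0 < vmin z ->
  (forall k, Dh z (emd A b x0 k.+1)
             <= Dh z (emd A b x0 k) * rate A z (Dh z (emd A b x0 k))) /\
  (forall k, Dh z (emd A b x0 k.+1)
             <= Dh z (emd A b x0 k) * rate A z (Dh z x0)) /\
  ((fun k : nat => (rate A z (Dh z (emd A b x0 k)) : R)) @ \oo --> (
     1 - lambda_min_pos (A^T *m A) * vmin z
         / (8 * max_col_sqnorm A * l1_norm z) : R)).
Proof.
move=> A0 _ x0_gt0 /set_mem[_ Az] _ xcvg zmin0.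
have z0 i : 0 < z i 0 := vmin_coord_gt0 zmin0 i.
have xk0 k i := emd_gt0 A b x0_gt0 k i.
have D0 k := Dh_ge0 (xk0 k) zmin0.
have step k : Dh z (emd A b x0 k.+1)
    <= Dh z (emd A b x0 k) * rate A z (Dh z (emd A b x0 k)).
  apply: Dh_step_rate => // v; exact: emd_ln_orthogonal.
(* Every contraction factor is at most 1; with [rate_le] this allows D_h(z, x_0) inside the
   fraction. *)
have decr k : Dh z (emd A b x0 k) <= Dh z x0.
  elim: k => // k; apply: le_trans; apply: le_trans (step k) _.
  rewrite ler_piMr// rateE gerBl.
  have [l0 _] := lambda_min_posP A0; have M0 := max_col_sqnorm_gt0 A0.
  have L0 := l1_norm_z_gt0 A0 zmin0.
  have [s0 _ _] := sigmaP (divr_ge0 (D0 k) (ltW zmin0)).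
  apply: divr_ge0; first by rewrite !mulr_ge0 ?ltW.
  by rewrite !mulr_ge0 ?addr_ge0 ?(ltW L0) ?(ltW M0).
split => //; split => [k|].
  by apply: le_trans (step k) _; rewrite ler_wpM2l// rate_le.
have Dcvg := Dh_emd_cvg0 x0_gt0 z0 xcvg.
under eq_cvg do rewrite rateE.
apply: cvgB; first exact: cvg_cst.
(* Displays in the target the limits 1 of [sigma] and 0 of D_h(z, x_k). *)
rewrite -[X in _ * X / _]mulr1 mulrA -[X in _ / (_ * X)]addr0.
apply: cvgM.
  apply: cvgM; first exact: cvg_cst.
  apply: cvg_sigma => [k|]; first by rewrite divr_ge0// ltW.
  rewrite -[X in _ --> X](mul0r (vmin z)^-1).
  by apply: cvgM => //; exact: cvg_cst.
apply: cvgV.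
  have M0 := max_col_sqnorm_gt0 A0; have L0 := l1_norm_z_gt0 A0 zmin0.
  by rewrite addr0 !mulf_neq0 ?gt_eqF.
apply: cvgM; first exact: cvg_cst.
by apply: cvgD => //; exact: cvg_cst.
Qed.
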